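(* Let $r\ge 0$ be an integer. The following spaces of differential $1$-forms on the triangle $T^2$ have bases that are $S_3$-invariant up to sign if and only if the corresponding condition holds: \begin{itemize} \item $\mathcal P_r\Lambda^1(T^2)$ if and only if $r\notin 3\mathbb N_0$; \item $\mathcal P_r^-\Lambda^1(T^2)$ if and only if $r\notin 3\mathbb N_0+2$; \item $\mathring{\mathcal P}_r\Lambda^1(T^2)$ if and only if $r\notin 3\mathbb N_0+3$; \item $\mathring{\mathcal P}_r^-\Lambda^1(T^2)$ if and only if $r\notin 3\mathbb N_0+2$. \end{itemize}
   Context: $T^n\subset\mathbb R^{n+1}$ is the standard simplex $\{(\lambda_0,\dots,\lambda_n):\lambda_i\ge 0,\ \sum_i\lambda_i=1\}$. $\mathcal P_r\Lambda^k(\mathbb R^{n+1})$ denotes the $k$-forms on $\mathbb R^{n+1}$ with polynomial coefficients of degree at most $r$ (zero if $r<0$). With $X$ the position vector field on $\mathbb R^{n+1}$ and $i_X$ contraction with $X$, $\mathcal P_r^-\Lambda^k(\mathbb R^{n+1}):=i_X\bigl(\mathcal P_{r-1}\Lambda^{k+1}(\mathbb R^{n+1})\bigr)$. The spaces $\mathcal P_r\Lambda^k(T^n)$ and $\mathcal P_r^-\Lambda^k(T^n)$ are the images of these spaces under restriction (pullback) to $T^n$. $\mathring{\mathcal P}_r\Lambda^k(T^n)$, $\mathring{\mathcal P}_r^-\Lambda^k(T^n)$ denote the subspaces of forms whose trace (pullback) vanishes on every $(n-1)$-dimensional face of $T^n$. The symmetric group $S_{n+1}$ (permutations of $\{0,\dots,n\}$)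 acts on these spaces as follows: for $\pi\in S_{n+1}$ let $S_\pi(\lambda_0,\dots,\lambda_n)=(\lambda_{\pi(0)},\dots,\lambda_{\pi(n)})$, and let $\pi$ act on forms by the pullback $S_\pi^*$. A basis $\xi_1,\dots,\xi_m$ of a representation $V$ of a group $G$ is $G$-invariant up to sign if for every $g\in G$ and every $i$ there is $i'$ with $g\xi_i=\pm\xi_{i'}$. $\mathbb N_0=\{0,1,2,\dots\}$ and $3\mathbb N_0+a=\{3m+a:m\in\mathbb N_0\}$. *)

(* Defs.v *)
From HB Require Import structures.
From mathcomp Require Import all_boot all_order all_algebra all_fingroup.
From mathcomp Require Import mpoly.
From mathcomp Require Import reals.

Set Implicit Arguments.
Unset Strict Implicit.
Unset Printing Implicit Defensive.

Import Order.TTheory GRing.Theory Num.Theory.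
Local Open Scope ring_scope.

Section Forms.
Variable R : realType.

Definition pt := 'I_3 -> R.

(* A 1-form on R^3 with polynomial coefficients: f i is the coefficient of d lambda_i. *)
Definition form1 := 'I_3 -> {mpoly R[3]}.

(* A 2-form on R^3, encoded as an antisymmetric matrix of polynomial
   coefficients: eta = sum_{j<k} eta j k  d lambda_j /\ d lambda_k. *)
Definition form2 := 'I_3 -> 'I_3 -> {mpoly R[3]}.

Definition evf (f : form1) (x v : pt) : R := \sum_(i < 3) (f i).@[x] * v i.

Definition inT2 (x : pt) : Prop := (forall i, 0 <= x i) /\ \sum_(i < 3) x i = 1.
Definition tangent (v : pt) : Prop := \sum_(i < 3) v i = 0.

Definition res_eq (f g : form1) : Prop :=
  forall x v, inT2 x -> tangent v -> evf f x v = evf g x v.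

(* P_r Lambda^1(R^3): coefficients of degree at most r (msize = 1 + degree). *)
Definition Pr (r : nat) (f : form1) : Prop := forall i, (msize (f i) <= r.+1)%N.

(* P_r^- Lambda^1(R^3) = i_X (P_{r-1} Lambda^2(R^3)); (i_X eta)_i = sum_j lambda_j eta_{j i}.
   Degree at most r-1 is msize <= r (which forces eta = 0 when r = 0). *)
Definition Pminus (r : nat) (f : form1) : Prop :=
  exists eta : form2,
    (forall j k, (msize (eta j k) <= r)%N) /\
    (forall j k, eta k j = - eta j k) /\
    (forall i, f i = \sum_(j < 3) 'X_j * eta j i).

Definition trace_vanishes (j : 'I_3) (f : form1) : Prop :=
  forall x v, inT2 x -> x j = 0 -> tangent v -> v j = 0 -> evf f x v = 0.

Definition traceless (f : form1) : Prop := forall j, trace_vanishes j f.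

Definition lincomb (m : nat) (c : 'I_m -> R) (xi : 'I_m -> form1) : form1 :=
  fun i => \sum_(k < m) c k *: xi k i.

Definition zero_form : form1 := fun _ => 0.

Definition Sperm (p : 'S_3) (x : pt) : pt := fun k => x (p k).

(* The space V = { restriction to T^2 of f | A f } has a basis that is
   S_3-invariant up to sign, where pi acts by the pullback S_pi^*
   (note (S_pi^* w)_x(v) = w_{S_pi x}(S_pi v), S_pi being linear).
   The basis is given through representatives xi k with A (xi k). *)
Definition has_inv_basis (A : form1 -> Prop) : Prop :=
  exists (m : nat) (xi : 'I_m -> form1),
    (forall k, A (xi k)) /\
    (forall c : 'I_m -> R, res_eq (lincomb c xi) zero_form -> forall k, c k = 0) /\
    (forall f, A f -> exists c : 'I_m -> R, res_eq f (lincomb c xi)) /\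
    (forall (p : 'S_3) (k : 'I_m), exists (k' : 'I_m) (s : R),
        (s = 1 \/ s = -1) /\
        forall x v, inT2 x -> tangent v ->
          evf (xi k) (Sperm p x) (Sperm p v) = s * evf (xi k') x v).

End Forms.

Definition in3N0 (a r : nat) : Prop := exists m : nat, r = (3 * m + a)%N.

(* Main.v *)
Require Import Defs.
From HB Require Import structures.
From mathcomp Require Import all_boot all_order all_algebra all_fingroup.
From mathcomp Require Import mpoly.
From mathcomp Require Import reals.
From mathcomp Require Import zify ring lra.

Set Implicit Arguments.
Unset Strict Implicit.
Unset Printing Implicit Defensive.
Import Order.TTheory GRing.Theory Num.Theory.
Local Open Scope ring_scope.

(* A representation of S_3 is a signed permutation representation exactly when the trace of
   the 3-cycle on it is nonnegative.  Each of the four spaces is generated by forms g (m, i),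
   where m is a monomial of fixed degree N (N = r, or N = r + 1 for the P^- spaces) and i is
   an index in {0, 1, 2}, and the only relations are g (m, 0) + g (m, 1) + g (m, 2) = 0
   for the m such that these three generators exist.
   If 3 does not divide N, the residues mod 3 of the exponents of m are neither all equal nor
   all distinct; dropping the generator g (m, i) whose exponent m_i has the isolated residue
   yields a basis which S_3 permutes up to sign.  If 3 divides N and the constant monomial
   m = (b, b, b) carries a relation, the 3-cycle fixes no generator and exactly this relation,
   so its trace is -1, while a signed permutation matrix of order 3 has trace at least 0. *)

(** * Cyclic arithmetic on the three indices *)

Lemma big3 (S : Type) (idx : S) (op : Monoid.com_law idx) (F : 'I_3 -> S) (i : 'I_3) :
  \big[op/idx]_k F k = op (F i) (op (F (i + 1)) (F (i + 1 + 1))).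
Proof.
rewrite (reindex_inj (addrI i)) !big_ord_recl big_ord0 addr0.
have -> : i + lift ord0 ord0 = i + 1 by congr (i + _); apply/val_inj.
have -> : i + lift ord0 (lift ord0 ord0) = i + 1 + 1.
  by rewrite -addrA; congr (i + _); apply/val_inj.
by rewrite (Monoid.mulm1 op).
Qed.

Lemma ord3_cases (i k : 'I_3) : [\/ k = i, k = i + 1 | k = i + 1 + 1].
Proof.
by move: i k => [[|[|[|]]] //= ?] [[|[|[|]]] //= ?];
   do ?[by constructor 1; apply/val_inj | by constructor 2; apply/val_inj
       | by constructor 3; apply/val_inj].
Qed.

Lemma ord3_neq (i : 'I_3) :
  [/\ (i + 1 == i) = false, (i + 1 + 1 == i) = false, (i == i + 1) = false,
      (i == i + 1 + 1) = false & ((i + 1 == i + 1 + 1) = false) * ((i + 1 + 1 == i + 1) = false)].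
Proof. by case: i => [[|[|[|]]]]. Qed.

(** * Homogeneous polynomials on the simplex: homogenisation and independence of monomials *)

Section Monomials.
Variables (R : realType) (n : nat).

(** The bound [n] makes exponents a finite type, so that sums over all monomials are plain big
    sums. *)
Definition expo := {ffun 'I_3 -> 'I_n.+1}.

Definition exps (m : expo) : 'I_3 -> nat := fun k => m k.

Definition deg (m : expo) : nat := (\sum_k m k)%N.

Definition monom (e : 'I_3 -> nat) (x : pt R) : R := \prod_k x k ^+ e k.

Definition mnm_of (e : 'I_3 -> nat) : 'X_{1..3} := [multinom e k | k < 3].

Lemma meval_mnm_of e x : ('X_[mnm_of e] : {mpoly R[3]}).@[x] = monom e x.
Proof. by rewrite mevalX; apply: eq_bigr => k _; rewrite mnmE. Qed.

Lemma monom0 (e : 'I_3 -> nat) x k : x k = 0 -> (0 < e k)%N -> monom e x = 0.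
Proof. by move=> xk ek; rewrite /monom (bigD1 k) //= xk expr0n eqn0Ngt ek mul0r. Qed.

(** On the simplex the coordinates add up to 1, so each monomial may be multiplied by a power of
    their sum until its degree is [N]. The bound [N <= n] makes the resulting exponents fit into
    [expo]. *)
Lemma homogenize (N : nat) (f : {mpoly R[3]}) : (N <= n)%N -> (msize f <= N.+1)%N ->
  exists c : expo -> R, forall x, inT2 x ->
    f.@[x] = \sum_(m | deg m == N) c m * monom (exps m) x.
Proof.
move=> leNn szf.
have [F homF FE] : exists2 F : {mpoly R[3]}, F \is N.-homog &
    forall x, inT2 x -> F.@[x] = f.@[x].
  exists (\sum_(m <- msupp f) f@_m *: ('X_[m] * (\sum_(i < 3) 'X_i) ^+ (N - mdeg m))).
    rewrite big_seq; apply: rpred_sum => m mf; apply/rpredZ.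
    have lem : (mdeg m <= N)%N by rewrite -ltnS (leq_trans (msize_mdeg_lt mf)).
    rewrite -{2}(subnKC lem); apply: dhomogM; first by rewrite dhomogX.
    rewrite -[X in X.-homog]mul1n; apply: dhomogMn; apply: rpred_sum => i _.
    by rewrite dhomogX /= mdeg1.
  move=> x [_ x1]; rewrite [in RHS](mpolyE f) !rmorph_sum; apply: eq_bigr => m _ /=.
  rewrite !mevalZ mevalM rmorphXn rmorph_sum /=.
  by under [X in X ^+ _]eq_bigr do rewrite mevalXU; rewrite x1 expr1n mulr1.
exists (fun m => F@_(mnm_of (exps m))) => x /FE <-.
rewrite [in LHS](_ : F = \sum_(m : expo | deg m == N)
    F@_(mnm_of (exps m)) *: 'X_[mnm_of (exps m)]); last first.
  apply/mpolyP => m'; rewrite raddf_sum /=.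
  under eq_bigr do rewrite mcoeffZ mcoeffX.
  have inj m : mnm_of (exps m) = m' -> m = [ffun k => inord (m' k)].
    by move=> <-; apply/ffunP => k; rewrite ffunE mnmE inord_val.
  have [dm|dm] := eqVneq (mdeg m') N; last first.
    rewrite (dhomog_nemf_coeff homF dm) big1 // => m /eqP degm.
    case: eqP => [e|]; rewrite ?mulr0 //; case/eqP: dm.
    by rewrite -e mdegE -degm; apply: eq_bigr => k _; rewrite mnmE.
  pose m : expo := [ffun k => inord (m' k)].
  have mE k : m k = m' k :> nat.
    rewrite ffunE inordK // ltnS (leq_trans _ leNn) // -dm mdegE.
    by rewrite (bigD1 k) //= leq_addr.
  have mm : mnm_of (exps m) = m' by apply/mnmP => k; rewrite mnmE /exps mE.
  rewrite (bigD1 m) /=; last by rewrite /deg -dm mdegE; apply/eqP/eq_bigr.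
  rewrite mm eqxx mulr1 big1 ?addr0 // => m2 /andP [_ ne].
  by case: eqP => [/inj e|]; rewrite ?mulr0 //; rewrite e eqxx in ne.
rewrite rmorph_sum; apply: eq_bigr => m _ /=.
by rewrite mevalZ meval_mnm_of.
Qed.

Lemma monom_scale (N : nat) (m : expo) (s : R) (x : pt R) : deg m = N ->
  monom (exps m) (fun k => s * x k) = s ^+ N * monom (exps m) x.
Proof.
move=> <-; rewrite /monom /deg -prodrXr -big_split.
by apply: eq_bigr => k _; rewrite exprMn.
Qed.

Lemma poly_pos_root0 (p : {poly R}) : (forall t, 0 < t -> p.[t] = 0) -> p = 0.
Proof.
move=> p0; apply/eqP/negPn/negP => nz.
have := @max_poly_roots R p [seq i.+1%:R | i <- iota 0 (size p)] nz.
rewrite size_map size_iota ltnn => H; suff: false by []; apply: H.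
  by apply/allP => _ /mapP [i _ ->]; rewrite rootE p0 ?ltr0Sn.
rewrite map_inj_uniq ?iota_uniq // => i j /eqP.
by rewrite eqr_nat => /eqP [].
Qed.

(** Kronecker substitution: the exponents, all at most [n], become digits in base [n.+1]. *)
Definition kronecker (m : expo) : nat := (m 0%R + n.+1 * (m 1%R + n.+1 * m (1 + 1)%R))%N.

Lemma kronecker_inj : injective kronecker.
Proof.
have base (a b p q : nat) : (a < n.+1)%N -> (b < n.+1)%N ->
    (a + n.+1 * p = b + n.+1 * q)%N -> a = b /\ p = q.
  move=> la lb e; have ab : a = b.
    have := congr1 (modn^~ n.+1) e.
    by rewrite ![(_ + n.+1 * _)%N]addnC ![(n.+1 * _)%N]mulnC !modnMDl !modn_small.
  by split=> //; move: e; rewrite ab => /addnI/eqP; rewrite eqn_pmul2l // => /eqP.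
move=> m m' /base [] // e0 /base [] // e1 e2; apply/ffunP => k; apply/val_inj.
by case: (ord3_cases 0 k) => ->; rewrite ?add0r.
Qed.

(* Points [t ^ B ^ k] with [B > n] tell all monomials apart, so that a single
   univariate polynomial in [t] records the coefficients. *)
Lemma monom_free (N : nat) (Z : pred 'I_3) (k0 : 'I_3) (c : expo -> R) : ~~ Z k0 ->
  (forall x, inT2 x -> (forall k, Z k -> x k = 0) ->
     \sum_(m | deg m == N) c m * monom (exps m) x = 0) ->
  forall m, deg m = N -> (forall k, Z k -> m k = 0 :> nat) -> c m = 0.
Proof.
move=> Zk0 c0.
pose w (k : 'I_3) := (n.+1 ^ k)%N.
pose y t k : R := if Z k then 0 else t ^+ w k.
pose okZ (m : expo) := [forall k, Z k ==> (m k == 0 :> nat)].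
have ymon t (m : expo) : monom (exps m) (y t) = (okZ m)%:R * t ^+ kronecker m.
  have [ok|] := boolP (okZ m); last first.
    rewrite negb_forall => /existsP [k]; rewrite negb_imply => /andP [Zk mk].
    by rewrite mul0r; apply: (@monom0 _ _ k); rewrite /y ?Zk // lt0n.
  rewrite mul1r (_ : kronecker m = \sum_k w k * m k)%N; last first.
    rewrite (big3 _ _ 0) /= add0r /kronecker /w /= expn0 expn1.
    by rewrite (_ : n.+1 ^ _ = n.+1 * n.+1)%N ?mulnn //; ring.
  rewrite -prodrXr; apply: eq_bigr => k _; rewrite /y.
  case: ifP => Zk; last by rewrite exprM.
  by move/forallP/(_ k): ok; rewrite Zk /= /exps => /eqP ->; rewrite muln0.
have sum0 t : 0 < t -> \sum_(m | deg m == N) c m * monom (exps m) (y t) = 0.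
  move=> t0; pose s := \sum_k y t k.
  have y_ge0 k : 0 <= y t k by rewrite /y; case: ifP => // _; rewrite exprn_ge0 // ltW.
  have s0 : 0 < s.
    rewrite /s (bigD1 k0) //= ltr_pwDl ?sumr_ge0 //.
    by rewrite /y (negbTE Zk0) exprn_gt0.
  (* Dividing by the coordinate sum [s] puts the point on the simplex; by homogeneity this only
     scales the sum by a nonzero power of [s^-1]. *)
  have : \sum_(m | deg m == N) c m * monom (exps m) (fun k => s^-1 * y t k) = 0.
    apply: c0 => [|k Zk]; last by rewrite /y Zk mulr0.
    split=> [k|]; first by rewrite mulr_ge0 // invr_ge0 ltW.
    by rewrite -mulr_sumr mulVf // gt_eqF.
  under eq_bigr => m /eqP dm do rewrite (monom_scale _ _ dm) mulrCA.
  rewrite -mulr_sumr => /eqP; rewrite mulf_eq0 expf_eq0 invr_eq0 (gt_eqF s0) andbF.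
  by move/eqP.
pose P := \sum_(m : expo | deg m == N) (c m * (okZ m)%:R) *: 'X^(kronecker m) : {poly R}.
have P0 : P = 0.
  apply: poly_pos_root0 => t /sum0 e; rewrite /P horner_sum -[RHS]e.
  by apply: eq_bigr => m _; rewrite hornerZ hornerXn ymon mulrA.
move=> m dm mZ; have := congr1 (fun p : {poly R} => p`_(kronecker m)) P0.
rewrite /P coef_sum coef0 (bigD1 m) /=; last by rewrite dm.
rewrite big1 ?addr0 => [|m' /andP [_ ne]]; last first.
  by rewrite coefZ coefXn (inj_eq kronecker_inj) eq_sym (negbTE ne) mulr0.
rewrite coefZ coefXn eqxx mulr1 (_ : okZ m) ?mulr1 //.
by apply/forallP => k; apply/implyP => /mZ ->.
Qed.

End Monomials.

(** * Invariant bases, and the obstruction to them, for an abstract presentation *)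

Section GeneratingSystem.
Variables (R : realType) (n : nat).

(** With the inverse, pulling a monomial back along [Sperm p] is the action of [p] on its
    exponents. *)
Definition expo_act (p : 'S_3) (m : expo n) : expo n := [ffun k => m ((p^-1)%g k)].

Lemma actE (p : 'S_3) (m : expo n) k : expo_act p m (p k) = m k.
Proof. by rewrite ffunE permK. Qed.

Lemma deg_act p m : deg (expo_act p m) = deg m.
Proof.
by rewrite /deg (reindex_inj (@perm_inj _ p)); apply: eq_bigr => k _; rewrite actE.
Qed.

Definition form_index := (expo n * 'I_3)%type.

Definition iact (p : 'S_3) (j : form_index) : form_index := (expo_act p j.1, p j.2).

Definition rot3 : 'S_3 := perm (@addIr _ (1 : 'I_3)).

Lemma rot3E i : rot3 i = i + 1. Proof. by rewrite permE. Qed.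

Lemma Sperm_rot3_3 (x : pt R) : Sperm rot3 (Sperm rot3 (Sperm rot3 x)) =1 x.
Proof.
move=> k; rewrite /Sperm !rot3E; congr x.
by case: k => [[|[|[|]]]] //= ?; apply/val_inj.
Qed.

Lemma inT2_Sperm p (x : pt R) : inT2 x -> inT2 (Sperm p x).
Proof.
case=> x0 x1; split=> [i|]; first exact: x0.
by rewrite -x1 [RHS](reindex_inj (@perm_inj _ p)).
Qed.

Lemma tangent_Sperm p (v : pt R) : tangent v -> tangent (Sperm p v).
Proof. by rewrite /tangent [X in X = _ -> _](reindex_inj (@perm_inj _ p)). Qed.

Definition on_T2 (P : pt R -> pt R -> Prop) : Prop :=
  forall x v, inT2 x -> tangent v -> P x v.

Lemma evf_ext (f : form1 R) x x' v v' : x =1 x' -> v =1 v' -> evf f x v = evf f x' v'.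
Proof.
by move=> ex ev; apply: eq_bigr => i _; rewrite ev (meval_eq _ ex).
Qed.

Lemma evf_lincomb q (c : 'I_q -> R) (xi : 'I_q -> form1 R) x v :
  evf (lincomb c xi) x v = \sum_k c k * evf (xi k) x v.
Proof.
rewrite /evf /lincomb; under eq_bigr => i _ do rewrite rmorph_sum mulr_suml.
rewrite exchange_big; apply: eq_bigr => k _ /=.
by rewrite mulr_sumr; apply: eq_bigr => i _; rewrite mevalZ mulrA.
Qed.

Lemma evf_zero x v : evf (@zero_form R) x v = 0.
Proof. by rewrite /evf big1 // => i _; rewrite /zero_form meval0 mul0r. Qed.

Lemma sum_supp (T : finType) (K : {set T}) (C F : T -> R) :
  (forall j, j \notin K -> C j = 0) ->
  \sum_j C j * F j = \sum_(k < #|K|) C (enum_val k) * F (enum_val k).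
Proof.
move=> C0; rewrite -(big_enum_val (fun j => C j * F j)) [RHS]big_mkcond /=.
by apply: eq_bigr => j _; case: ifPn => // /C0 ->; rewrite mul0r.
Qed.

(* A presentation of a space of forms on [T^2]: the generators are the [g j]
   with [ok j], and the relations are the sums of the three generators [g (m, i)],
   for those [m] for which all three exist. *)
Record generating_system (A : form1 R -> Prop) (N : nat) (ok : pred form_index)
    (g : form_index -> form1 R) (s : 'S_3 -> R) : Prop := {
  gs_mem : forall j, ok j -> A (g j);
  gs_deg : forall j, ok j -> deg j.1 = N;
  gs_span : forall f, A f -> exists c : form_index -> R,
    (forall j, ~~ ok j -> c j = 0) /\
    on_T2 (fun x v => evf f x v = \sum_j c j * evf (g j) x v);
  gs_kernel : forall c : form_index -> R, (forall j, ~~ ok j -> c j = 0) ->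
    on_T2 (fun x v => \sum_j c j * evf (g j) x v = 0) ->
    forall m i i', c (m, i) = c (m, i');
  gs_relation : forall m, (forall i, ok (m, i)) ->
    on_T2 (fun x v => \sum_i evf (g (m, i)) x v = 0);
  gs_act : forall p j, ok j ->
    on_T2 (fun x v => evf (g j) (Sperm p x) (Sperm p v) = s p * evf (g (iact p j)) x v);
  gs_ok_act : forall p j, ok (iact p j) = ok j;
  gs_sign : forall p, s p = 1 \/ s p = -1;
  gs_sign_rot3 : s rot3 = 1
}.

Variables (A : form1 R -> Prop) (N : nat) (ok : pred form_index) (g : form_index -> form1 R)
  (s : 'S_3 -> R) (gs : generating_system A N ok g s).

Definition full (m : expo n) := [forall i, ok (m, i)].

Lemma full_act p m : full (expo_act p m) = full m.
Proof.
apply/forallP/forallP => h i; last first.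
  by have := h ((p^-1)%g i); rewrite -(gs_ok_act gs p) /iact /= permKV.
by have := h (p i); rewrite -(gs_ok_act gs p (m, i)).
Qed.

Definition odd_one_out (m : expo n) (i : 'I_3) :=
  [forall k, (k != i) ==> (m k != m i %[mod 3])].

Lemma odd_one_out_act p m i : odd_one_out (expo_act p m) (p i) = odd_one_out m i.
Proof.
apply/forallP/forallP => h k.
  by have := h (p k); rewrite !actE (inj_eq perm_inj).
by rewrite -(permKV p k) !actE (inj_eq perm_inj); apply: h.
Qed.

Lemma odd_one_outE m i :
  odd_one_out m i = (m (i + 1) != m i %[mod 3]) && (m (i + 1 + 1) != m i %[mod 3]).
Proof.
have [h1 h2 _ _ _] := ord3_neq i.
apply/forallP/andP => [h|[a b] k].
  by have := h (i + 1); have := h (i + 1 + 1); rewrite h1 h2.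
by case: (ord3_cases i k) => ->; rewrite ?eqxx ?h1 ?h2.
Qed.

Lemma addI3 (i : 'I_3) : i + 1 + 1 + 1 = i.
Proof. by apply/val_inj; case: i => [[|[|[|]]]]. Qed.

Lemma deg3 (m : expo n) i : deg m = (m i + (m (i + 1)%R + m (i + 1 + 1)%R))%N.
Proof. by rewrite /deg (big3 _ _ i). Qed.

(** Three residues without an odd one out are all equal, so their sum is divisible by 3. *)
Lemma odd_one_out_exists m : ~~ (3 %| deg m)%N -> exists i, odd_one_out m i.
Proof.
rewrite (deg3 m 0) => d; case: (boolP (odd_one_out m 0)) => [|h0]; first by exists 0.
case: (boolP (odd_one_out m (0 + 1))) => [|h1]; first by exists (0 + 1).
exists (0 + 1 + 1); move: d h0 h1; rewrite !odd_one_outE !addI3.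
move: (nat_of_ord _) (nat_of_ord _) (nat_of_ord _) => a b c; lia.
Qed.

(** Two odd ones out make the residues 0, 1, 2 in some order, again with sum divisible by 3. *)
Lemma odd_one_out_uniq m i i' : ~~ (3 %| deg m)%N ->
  odd_one_out m i -> odd_one_out m i' -> i = i'.
Proof.
rewrite (deg3 m i) !odd_one_outE.
case: (ord3_cases i i') => ->; rewrite ?addI3 //;
by move: (nat_of_ord _) (nat_of_ord _) (nat_of_ord _) => a b c; lia.
Qed.

(** The set [K] of kept generators is stable under the action because being the odd one out is
    equivariant. Exactly one generator is dropped for each relation. *)
Lemma has_inv_basis_of_system : (forall m, full m -> ~~ (3 %| deg m)%N) -> has_inv_basis A.
Proof.
move=> d3.
pose K := [set j | ok j & ~~ (full j.1 && odd_one_out j.1 j.2)].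
pose xi (k : 'I_#|K|) := g (enum_val k).
have Kact p j : (iact p j \in K) = (j \in K).
  by rewrite !inE (gs_ok_act gs) full_act odd_one_out_act.
have Kok j : j \in K -> ok j by rewrite inE => /andP [].
exists #|K|, xi; split; [|split; [|split]].
- by move=> k; apply: (gs_mem gs); apply: Kok; apply: enum_valP.
- move=> c c0 k.
  (* [C] extends [c] by zero from [K] to all indices. *)
  pose C j := \sum_(k : 'I_#|K|) (enum_val k == j)%:R * c k.
  have CK j : j \notin K -> C j = 0.
    move=> nK; rewrite /C big1 // => k' _; case: eqP => [e|]; rewrite ?mul0r //.
    by rewrite -e enum_valP in nK.
  have Ck k' : C (enum_val k') = c k'.
    rewrite /C (bigD1 k') //= eqxx mul1r big1 ?addr0 // => k2 ne.
    by rewrite (inj_eq enum_val_inj) (negbTE ne) mul0r.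
  have cst : forall m i i', C (m, i) = C (m, i').
    apply: (gs_kernel gs) => [j nok|x v Tx Tv].
      by apply: CK; apply: contra nok => /Kok.
    have := c0 x v Tx Tv; rewrite evf_lincomb evf_zero => e.
    rewrite -[RHS]e (sum_supp _ CK); apply: eq_bigr => k' _.
    by rewrite Ck.
  rewrite -Ck; have := enum_valP k; case: (enum_val k) => m i mK.
  (* The coefficients at [m] agree, and one of them is zero: that of a missing generator if [m] is
     not full, that of the dropped one if it is. *)
  have [fm|] := boolP (full m); last first.
    rewrite negb_forall => /existsP [i' nok]; rewrite (cst _ _ i').
    by apply: CK; apply: contra nok => /Kok.
  have [i' odd_i'] := odd_one_out_exists (d3 _ fm).
  by rewrite (cst _ _ i'); apply: CK; rewrite inE /= fm odd_i' andbF.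
- move=> f /(gs_span gs) [c [c0 fE]].
  (* The sum has a single term, the coefficient of the dropped generator; subtracting this multiple
     of the relation at [m] clears it. *)
  pose d m := if full m then \sum_(i | odd_one_out m i) c (m, i) else 0.
  exists (fun k => c (enum_val k) - d (enum_val k).1) => x v Tx Tv.
  pose C j := if ok j then c j - d j.1 else 0.
  have CK j : j \notin K -> C j = 0.
    rewrite inE negb_and negbK /C; case: ifP => //= okj /andP [fm odd_j].
    case: j okj fm odd_j => m i /= okj fm odd_j.
    rewrite /d fm (bigD1 i) //= big1 ?addr0 ?subrr // => i' /andP [odd_i' /eqP []].
    exact: odd_one_out_uniq (d3 _ fm) odd_i' odd_j.
  rewrite evf_lincomb fE //; transitivity (\sum_j C j * evf (g j) x v); last first.
    rewrite (sum_supp _ CK); apply: eq_bigr => k _.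
    by rewrite /C (Kok _ (enum_valP k)).
  apply/eqP; rewrite -subr_eq0 -sumrB; apply/eqP.
  transitivity (\sum_m \sum_i d m * evf (g (m, i)) x v).
    rewrite pair_bigA /=; apply: eq_bigr => -[m i] _ /=; rewrite /C.
    case: ifP => [okj|/negbT nok]; first by rewrite -mulrBl; congr (_ * _); ring.
    rewrite c0 // /d ifF ?mul0r ?subrr //.
    by apply/negP => /forallP /(_ i); apply/negP.
  rewrite big1 // => m _; rewrite -mulr_sumr /d; case: ifP => fm; last by rewrite mul0r.
  by rewrite (gs_relation gs) ?mulr0 //; apply/forallP.
- move=> p k; have pK : iact p (enum_val k) \in K by rewrite Kact enum_valP.
  exists (enum_rank_in pK (iact p (enum_val k))), (s p); split; first exact: gs_sign gs p.
  move=> x v Tx Tv; rewrite /xi enum_rankK_in //.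
  by apply: (gs_act gs) => //; apply: Kok; apply: enum_valP.
Qed.

(* Let [xi = P g] and [g = Q xi].  The trace of the 3-cycle in the basis [xi] is
   [\sum_j (Q P) (rho j, j)]; as [Q P] is the identity modulo relations, this is
   minus the number of full [m] fixed by [rho].  On the other hand the diagonal entries
   of a signed permutation matrix of order 3 are 0 or 1. *)
Lemma no_inv_basis_of_system m0 : full m0 -> expo_act rot3 m0 = m0 -> ~ has_inv_basis A.
Proof.
move=> full_m0 fix_m0 [q [xi [xiA [xi_free [xi_span xi_inv]]]]].
have freeE (c : 'I_q -> R) :
    on_T2 (fun x v => \sum_k c k * evf (xi k) x v = 0) -> forall k, c k = 0.
  by move=> c0; apply: xi_free => x v Tx Tv; rewrite evf_lincomb evf_zero c0.
have [P PE] := fin_all_exists (fun k => gs_span gs (xiA k)).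
have P0 k j : ~~ ok j -> P k j = 0 by case: (PE k) => + _; apply.
have {}PE k : on_T2 (fun x v => evf (xi k) x v = \sum_j P k j * evf (g j) x v).
  by case: (PE k).
(* The condition [ok j] stands under the existential so that [Q] is total; outside the generators
   the witness is zero. *)
have /fin_all_exists [Q QE] : forall j, exists d : 'I_q -> R,
    ok j -> on_T2 (fun x v => evf (g j) x v = \sum_k d k * evf (xi k) x v).
  move=> j; have [okj|_] := boolP (ok j); last by exists (fun=> 0).
  have [d dE] := xi_span _ (gs_mem gs okj).
  by exists d => _ x v Tx Tv; rewrite dE // evf_lincomb.
have /fin_all_exists [sigma /fin_all_exists [e eE]] := xi_inv rot3.
pose rho := iact rot3.
have ok_rho j : ok (rho j) = ok j by apply: gs_ok_act gs _ _.
have rhoN j : (rho j == j) = false.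
  apply/eqP => /(congr1 snd) /=; rewrite rot3E => /eqP.
  by have [-> _ _ _ _] := ord3_neq j.2.
(* The matrix of the 3-cycle in the basis [xi], computed through the generators, is by freeness the
   given signed permutation matrix. *)
have PQrho k k' : \sum_j P k j * Q (rho j) k' = e k * (sigma k == k')%:R.
  apply/eqP; rewrite -subr_eq0; apply/eqP.
  apply: (freeE (fun k' => \sum_j P k j * Q (rho j) k' - e k * (sigma k == k')%:R)).
  move=> x v Tx Tv.
  under eq_bigr do rewrite mulrBl; rewrite sumrB.
  rewrite [X in _ - X](bigD1 (sigma k)) //= eqxx mulr1 -(proj2 (eE k)) //.
  rewrite [X in _ - (_ + X)]big1 ?addr0; last first.
    by move=> k2 ne; rewrite eq_sym (negbTE ne) mulr0 mul0r.
  rewrite (PE k _ _ (inT2_Sperm rot3 Tx) (tangent_Sperm rot3 Tv)).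
  under eq_bigr do rewrite mulr_suml; rewrite exchange_big -sumrB big1 // => j _ /=.
  have [okj|nok] := boolP (ok j); last first.
    by rewrite P0 // mul0r subr0 big1 // => k2 _; rewrite !mul0r.
  rewrite (gs_act gs) // (gs_sign_rot3 gs) mul1r QE ?ok_rho // mulr_sumr -sumrB.
  by rewrite big1 // => k2 _; rewrite mulrA subrr.
(* A basis form sent to its own negative by the 3-cycle would equal its negative after three turns,
   hence vanish. *)
have e_ge0 k : sigma k = k -> 0 <= e k.
  move=> fixk; case: (eE k) => -[-> _|ek]; rewrite ?ler01 // fixk ek => eE1.
  suff : (fun k' => (k' == k)%:R) k = 0 :> R by rewrite eqxx => /eqP; rewrite oner_eq0.
  apply: (freeE (fun k' => (k' == k)%:R)) => x v Tx Tv.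
  rewrite (bigD1 k) //= eqxx mul1r big1 ?addr0; last first.
    by move=> k' /negbTE ->; rewrite mul0r.
  have := evf_ext (xi k) (Sperm_rot3_3 x) (Sperm_rot3_3 v).
  rewrite !eE1 //; try by do ?[apply: inT2_Sperm | apply: tangent_Sperm].
  by lra.
pose E j j' := \sum_k Q j k * P k j'.
have E0 j j' : ~~ ok j' -> E j j' = 0.
  by move=> nok; rewrite /E big1 // => k _; rewrite P0 // mulr0.
(* The product [E] of [Q] and [P] re-expands a generator in the generators, so its difference from
   the identity is a relation, hence constant in [i]. *)
have EK j m i i' : ok j ->
    E j (m, i) - (j == (m, i))%:R = E j (m, i') - (j == (m, i'))%:R.
  move=> okj; apply: (gs_kernel gs (c := fun j' => E j j' - (j == j')%:R)) => [j' nok|x v Tx Tv].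
    by rewrite E0 //; case: eqP => [e'|]; rewrite ?subrr //; rewrite -e' okj in nok.
  under eq_bigr do rewrite mulrBl; rewrite sumrB.
  rewrite [X in _ - X](bigD1 j) //= eqxx mul1r [X in _ - (_ + X)]big1 ?addr0; last first.
    by move=> j' ne; rewrite eq_sym (negbTE ne) mul0r.
  under eq_bigr do rewrite mulr_suml.
  rewrite exchange_big QE // -sumrB big1 // => k _ /=.
  by rewrite PE // mulr_sumr -sumrB big1 // => j' _; rewrite mulrA subrr.
(* For full [m], [EK] moves every column to [(m, 0)]. The rows [rho (m, i)] then add up to zero by
   the relation at the rotated exponents, which leaves one Kronecker delta when [m] is fixed. *)
have tr_m m : \sum_i E (rho (m, i)) (m, i) = - (full m && (expo_act rot3 m == m))%:R.
  have [fm|] := boolP (full m); last first.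
    rewrite negb_forall => /existsP [i' nok]; rewrite oppr0 big1 // => i _.
    have [oki|noki] := boolP (ok (m, i)); last by rewrite E0.
    have := @EK (rho (m, i)) m i i'; rewrite ok_rho rhoN subr0 => -> //.
    rewrite E0 //; case: eqP => [e'|]; rewrite ?subrr //.
    by rewrite -e' ok_rho oki in nok.
  have okm i : ok (m, i) by apply/forallP: i.
  under eq_bigr => i _.
    have := @EK (rho (m, i)) m i 0; rewrite ok_rho rhoN subr0 => -> //.
    over.
  rewrite sumrB /= [X in X - _](_ : _ = 0) ?sub0r.
    congr (- _); rewrite (bigD1 ((rot3^-1)%g 0)) //= big1 ?addr0.
      by rewrite /rho /iact /= xpair_eqE permKV eqxx andbT.
    move=> i ne; rewrite /rho /iact /= xpair_eqE.
    by rewrite (can2_eq (permK rot3) (permKV rot3)) (negbTE ne) andbF.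
  rewrite exchange_big big1 //= => k _; rewrite -mulr_suml.
  suff -> : \sum_i Q (rho (m, i)) k = 0 by rewrite mul0r.
  apply: (freeE (fun k => \sum_i Q (rho (m, i)) k)) => x v Tx Tv.
  under eq_bigr do rewrite mulr_suml; rewrite exchange_big /=.
  have okr i : ok (expo_act rot3 m, i).
    by have /forallP := etrans (full_act rot3 m) fm; apply.
  have := gs_relation gs okr Tx Tv; rewrite (reindex_inj (@perm_inj _ rot3)) /= => rel0.
  by rewrite -[RHS]rel0; apply: eq_bigr => i _; rewrite QE.
have : 0 <= \sum_k \sum_j P k j * Q (rho j) k.
  apply: sumr_ge0 => k _; rewrite PQrho.
  by case: eqP => [/e_ge0|]; rewrite ?mulr1 ?mulr0.
apply/negP; rewrite -ltNge exchange_big /=.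
have -> : \sum_j \sum_k P k j * Q (rho j) k = \sum_m \sum_i E (rho (m, i)) (m, i).
  rewrite [RHS]pair_bigA /=; apply: eq_bigr => -[m i] _; rewrite /E.
  by apply: eq_bigr => k _; rewrite mulrC.
under eq_bigr do rewrite tr_m; rewrite sumrN oppr_lt0 (bigD1 m0) //=.
by rewrite full_m0 fix_m0 eqxx ltr_pwDl ?ltr01 // sumr_ge0 // => m _; rewrite ler0n.
Qed.

End GeneratingSystem.

(** * Monomial forms: presentations of the full polynomial spaces *)

Section Families.
Variables (R : realType) (n : nat).
Implicit Types (j : form_index n) (m : expo n).

Lemma monom_act p m (x : pt R) :
  monom (exps (expo_act p m)) x = monom (exps m) (Sperm p x).
Proof.
rewrite /monom (reindex_inj (@perm_inj _ p)).
by apply: eq_bigr => k _; rewrite /exps actE.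
Qed.

Lemma sum_index (F : form_index n -> R) : \sum_j F j = \sum_m \sum_i F (m, i).
Proof. by rewrite pair_bigA; apply: eq_bigr => -[]. Qed.

Lemma monom_free_supp (N : nat) (Z : pred 'I_3) k0 (c : expo n -> R) : ~~ Z k0 ->
  (forall m, deg m != N -> c m = 0) ->
  (forall x, inT2 x -> (forall k, Z k -> x k = 0) ->
     \sum_m c m * monom (exps m) x = 0) ->
  forall m, (forall k, Z k -> m k = 0 :> nat) -> c m = 0.
Proof.
move=> Zk0 supp c0 m mZ; have [dm|/supp //] := eqVneq (deg m) N.
apply: (monom_free Zk0 _ dm mZ) => x Tx xZ; rewrite big_mkcond -[RHS](c0 _ Tx xZ).
by apply: eq_bigr => m' _; case: ifPn => // /supp ->; rewrite mul0r.
Qed.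

(** This makes all traces of [x^m dx_i] vanish: [dx_i] vanishes on the face [x i = 0], and the
    monomial vanishes on the two others. It also says that [x^m] is divisible by the two coordinates
    other than [x i]. *)
Definition positive_off j := [forall k, (k != j.2) ==> (0 < j.1 k)%N].

Definition positive m := [forall k, 0 < m k]%N.

Lemma positive_offP j k : positive_off j -> k != j.2 -> (0 < j.1 k)%N.
Proof. by move=> /forallP /(_ k) /implyP; apply. Qed.

Lemma positive_off_act p j : positive_off (iact p j) = positive_off j.
Proof.
apply/forallP/forallP => h k; first by have := h (p k); rewrite !actE (inj_eq perm_inj).
by rewrite -(permKV p k) actE (inj_eq perm_inj).
Qed.

Lemma positive_act p m : positive (expo_act p m) = positive m.
Proof.
apply/forallP/forallP => h k; first by have := h (p k); rewrite actE.
by rewrite -(permKV p k) actE.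
Qed.

Lemma positiveW j : positive j.1 -> positive_off j.
Proof. by move=> /forallP h; apply/forallP => k; rewrite h implybT. Qed.

Lemma positive_off_all m : (forall i, positive_off (m, i)) -> positive m.
Proof.
move=> h; apply/forallP => k; apply: (positive_offP (h (k + 1))).
by have [_ _ /= -> _ _] := ord3_neq k.
Qed.

Definition mform j : form1 R := fun k => if k == j.2 then 'X_[mnm_of (exps j.1)] else 0.

Lemma evf_mform j (x v : pt R) : evf (mform j) x v = monom (exps j.1) x * v j.2.
Proof.
rewrite /evf (bigD1 j.2) //= /mform eqxx meval_mnm_of big1 ?addr0 // => k /negbTE ->.
by rewrite meval0 mul0r.
Qed.

Lemma mform_Pr r j : deg j.1 = r -> Pr r (mform j).
Proof.
move=> dj i; rewrite /mform; case: ifP => _; last by rewrite msize0.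
rewrite msizeX ltnS mdegE -dj; apply/eq_leq/eq_bigr => k _.
by rewrite mnmE.
Qed.

Lemma mform_traceless j : positive_off j -> traceless (mform j).
Proof.
move=> pj k x v _ xk _ vk; rewrite evf_mform.
have [<-|ne] := eqVneq k j.2; first by rewrite vk mulr0.
by rewrite (monom0 xk) ?mul0r // positive_offP.
Qed.

(** The edge vector of the triangle from vertex [i'] to vertex [i]. *)
Definition unit_diff (i i' : 'I_3) : pt R := fun k => (k == i)%:R - (k == i')%:R.

Lemma tangent_unit_diff i i' : tangent (unit_diff i i').
Proof.
rewrite /tangent /unit_diff sumrB (bigD1 i) //= (bigD1 i' (P := predT)) //= !eqxx.
by rewrite !big1 ?addr0 ?subrr // => k /negbTE ->.
Qed.

Lemma sum_unit_diff (c : 'I_3 -> R) i i' :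
  \sum_k c k * unit_diff i i' k = c i - c i'.
Proof.
rewrite /unit_diff; under eq_bigr do rewrite mulrBr; rewrite sumrB.
rewrite (bigD1 i) //= (bigD1 i' (P := predT)) //= !eqxx !mulr1.
by rewrite !big1 ?addr0 // => k /negbTE ->; rewrite mulr0.
Qed.

Lemma mform_sum_unit_diff (c : form_index n -> R) i i' x :
  \sum_j c j * evf (mform j) x (unit_diff i i') =
  \sum_m (c (m, i) - c (m, i')) * monom (exps m) x.
Proof.
rewrite sum_index; apply: eq_bigr => m _.
rewrite -(sum_unit_diff (fun k => c (m, k))) mulr_suml.
by apply: eq_bigr => k _; rewrite evf_mform /=; ring.
Qed.

(** Only spanning depends on the space. The relations come from [dx_0 + dx_1 + dx_2 = 0] on tangent
    vectors, and testing on edge vectors shows that there are no others. *)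
Lemma mform_system A N (ok : pred (form_index n)) :
  (forall j, ok j -> A (mform j)) -> (forall j, ok j -> deg j.1 = N) ->
  (forall p j, ok (iact p j) = ok j) ->
  (forall f, A f -> exists c : form_index n -> R, (forall j, ~~ ok j -> c j = 0) /\
    on_T2 (fun x v => evf f x v = \sum_j c j * evf (mform j) x v)) ->
  generating_system A N ok mform (fun=> 1).
Proof.
move=> okA okN ok_act spanA; split=> //.
- move=> c c0 ker m i i'.
  apply/eqP; rewrite -subr_eq0; apply/eqP.
  apply: (@monom_free_supp N pred0 0 (fun m => c (m, i) - c (m, i')) _ _ _ m) => //.
    move=> m' dm; rewrite !c0 ?subrr //; apply: contra dm => /okN /= ->; exact: eqxx.
  by move=> x Tx _; rewrite -mform_sum_unit_diff ker //; apply: tangent_unit_diff.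
- move=> m okm x v _ Tv; under eq_bigr do rewrite evf_mform /=.
  by rewrite -mulr_sumr Tv mulr0.
- by move=> p j okj x v _ _; rewrite !evf_mform /= monom_act mul1r.
- by left.
Qed.

Definition okdeg (N : nat) : pred (form_index n) := fun j => deg j.1 == N.

Definition okoff (N : nat) : pred (form_index n) :=
  fun j => (deg j.1 == N) && positive_off j.

Definition okpos (N : nat) : pred (form_index n) :=
  fun j => (deg j.1 == N) && positive j.1.

Lemma Pr_span r f : (r <= n)%N -> Pr r f -> exists c : form_index n -> R,
  (forall j, ~~ okdeg r j -> c j = 0) /\
  on_T2 (fun x v => evf f x v = \sum_j c j * evf (mform j) x v).
Proof.
move=> rn fr; have /fin_all_exists [c cE] := fun i => homogenize rn (fr i).
exists (fun j => if okdeg r j then c j.2 j.1 else 0); split=> [j /negbTE -> //|x v Tx _].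
rewrite sum_index exchange_big; apply: eq_bigr => i _ /=.
rewrite cE // big_mkcond mulr_suml; apply: eq_bigr => m _.
by rewrite evf_mform /okdeg /=; case: ifP; rewrite ?mul0r // mulrA.
Qed.

Lemma Pr_system r : (r <= n)%N ->
  generating_system (@Pr R r) r (okdeg r) mform (fun=> 1).
Proof.
move=> rn; apply: mform_system => [j /eqP|j /eqP //|p j|f].
- exact: mform_Pr.
- by rewrite /okdeg deg_act.
- exact: Pr_span.
Qed.

Lemma Pr_traceless_system r : (r <= n)%N ->
  generating_system (fun f => @Pr R r f /\ traceless f) r (okoff r) mform (fun=> 1).
Proof.
move=> rn; apply: mform_system => [j /andP [/eqP dj pj]|j /andP [/eqP ] //|p j|f [fr tr]].
- by split; [apply: mform_Pr | apply: mform_traceless].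
- by rewrite /okoff positive_off_act deg_act.
have [c [c0 cE]] := Pr_span rn fr.
(* The edge vector from [i'] to [i] is tangent to the face [x k = 0], where only monomials free of
   [x k] survive. *)
have cface k i i' m : i != k -> i' != k -> m k = 0 :> nat -> c (m, i) = c (m, i').
  move=> ik i'k mk; apply/eqP; rewrite -subr_eq0; apply/eqP.
  apply: (@monom_free_supp r (pred1 k) i (fun m => c (m, i) - c (m, i')) _ _ _ m) => //.
  - by move=> m' dm; rewrite !c0 ?subrr.
  - move=> x Tx xk; rewrite -mform_sum_unit_diff -cE //; last exact: tangent_unit_diff.
    apply: tr => //; [exact/xk/eqxx|exact: tangent_unit_diff|].
    by rewrite /unit_diff [k == i]eq_sym [k == i']eq_sym (negbTE ik) (negbTE i'k) subrr.
  - by move=> _ /eqP ->.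
(* [F m] is the multiple of the relation at [m] that clears every inadmissible coefficient. If [m 0]
   is positive, any vanishing exponent [m k] has [k != 0], so face [k] links the coefficient to
   index 0; if [m 0] is zero, face 0 links indices 1 and 2. *)
pose F m := if m 0 == 0 :> nat then c (m, 1) else c (m, 0).
exists (fun j => c j - F j.1); split=> [[m i]|x v Tx Tv].
  rewrite negb_and => /orP [dm|].
    by rewrite /F !c0 //; case: ifP; rewrite subrr.
  rewrite negb_forall => /existsP [k]; rewrite negb_imply /= -eqn0Ngt eq_sym => /andP [ik /eqP mk].
  apply/eqP; rewrite subr_eq0; apply/eqP; rewrite /F; case: ifP => [/eqP m0|m0].
    have [i0|i0] := eqVneq i 0; last exact: (cface 0).
    have [k1|k1] := eqVneq k 1; last by apply: (cface k); rewrite // eq_sym.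
    by rewrite (cface k i (1 + 1)) ?(cface 0 (1 + 1) 1) // k1.
  have k0 : k != 0 by apply: contraFneq m0 => <-; rewrite mk.
  by apply: (cface k) => //; rewrite eq_sym.
rewrite cE // sum_index [RHS]sum_index; apply: eq_bigr => m _.
under [RHS]eq_bigr do rewrite mulrBl; rewrite sumrB /= -mulr_sumr.
under [X in _ * X]eq_bigr do rewrite evf_mform /=.
by rewrite -mulr_sumr Tv !mulr0 subr0.
Qed.

End Families.

(** * Whitney forms: presentations of the spaces [Pminus] *)

Section WhitneyFamily.
Variables (R : realType) (n : nat).
Implicit Types (j : form_index n) (m : expo n).

(* [wform (m, i)] is [x^m phi_i / (x_{i+1} x_{i+2})] with [phi_i] the Whitney form
   [x_{i+1} dx_{i+2} - x_{i+2} dx_{i+1}]; with this indexing by the total monomial [m],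
   the Koszul relation [\sum_i x_i phi_i = 0] relates the three generators of equal [m]. *)
Definition whitney (i : 'I_3) (x v : pt R) : R :=
  x (i + 1) * v (i + 1 + 1) - x (i + 1 + 1) * v (i + 1).

(** The exponents of [x^m / (x_{i+1} x_{i+2})]; the truncated subtraction is faithful under
    [positive_off]. *)
Definition reduced j : 'I_3 -> nat := fun k => (j.1 k - (k != j.2))%N.

Definition levi_civita (i b a : 'I_3) : R :=
  ((b == i + 1) && (a == i + 1 + 1))%:R - ((b == i + 1 + 1) && (a == i + 1))%:R.

Definition wcoef j : form2 R := fun b a => levi_civita j.2 b a *: 'X_[mnm_of (reduced j)].

Definition wform j : form1 R := fun a => \sum_b 'X_b * wcoef j b a.

(** Contraction with the position field turns [dx_{i+1} /\ dx_{i+2}] into the Whitney form of index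
    [i]; [h] holds the coordinates of a 2-form in this basis. *)
Lemma evf_contraction (h : 'I_3 -> R) (x v : pt R) :
  \sum_a (\sum_b x b * \sum_i levi_civita i b a * h i) * v a = \sum_i h i * whitney i x v.
Proof.
rewrite !(big3 _ _ 0) /= /levi_civita /whitney !addI3.
have [e1 e2 e3 e4 [e5 e6]] := ord3_neq 0.
rewrite !(e1, e2, e3, e4, e5, e6, eqxx) /=; ring.
Qed.

Lemma evf_wform j (x v : pt R) :
  evf (wform j) x v = monom (reduced j) x * whitney j.2 x v.
Proof.
transitivity (\sum_i (i == j.2)%:R * monom (reduced j) x * whitney i x v); last first.
  rewrite (bigD1 j.2) //= eqxx mul1r big1 ?addr0 // => k /negbTE ->.
  by rewrite !mul0r.
rewrite -evf_contraction; apply: eq_bigr => a _; congr (_ * _).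
rewrite rmorph_sum; apply: eq_bigr => b _ /=.
rewrite mevalM mevalXU mevalZ meval_mnm_of; congr (_ * _).
rewrite (bigD1 j.2) //= eqxx mul1r big1 ?addr0 // => k /negbTE ->.
by rewrite !mul0r mulr0.
Qed.

Lemma monom_reduced j (x : pt R) : positive_off j ->
  monom (reduced j) x * (x (j.2 + 1) * x (j.2 + 1 + 1)) = monom (exps j.1) x.
Proof.
move=> pj; rewrite /monom !(big3 _ _ j.2) /= /reduced.
have [e1 e2 _ _ _] := ord3_neq j.2; rewrite eqxx e1 e2 subn0 /exps.
have p1 := positive_offP pj (negbT e1); have p2 := positive_offP pj (negbT e2).
rewrite -[in RHS](prednK p1) -[in RHS](prednK p2) !exprSr !subn1; ring.
Qed.

(** Two exponents drop by one, so total degree [r.+1] leaves degree [r - 1] for the coefficients of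
    the 2-form. *)
Lemma wform_Pminus r j : deg j.1 = r.+1 -> positive_off j -> Pminus r (wform j).
Proof.
move=> dj pj; exists (wcoef j); split; [|split] => // b a.
- apply: leq_trans (msizeZ_le _ _) _; rewrite msizeX mdegE.
  have [e1 e2 _ _ _] := ord3_neq j.2.
  have p1 := positive_offP pj (negbT e1); have p2 := positive_offP pj (negbT e2).
  move: dj; rewrite (deg3 _ j.2) (big3 _ _ j.2) /= !mnmE /reduced eqxx e1 e2 subn0 !subn1.
  move: p1 p2; move: (nat_of_ord _) (nat_of_ord _) (nat_of_ord _) => ? ? ?; lia.
- rewrite /wcoef -scaleNr /levi_civita opprB.
  by congr ((_ - _) *: _); rewrite andbC.
Qed.

(** On the face opposite to vertex [i] the monomial vanishes, as [reduced] keeps the exponent [m i];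
    on the other two faces the Whitney form itself vanishes. *)
Lemma wform_traceless j : positive j.1 -> traceless (wform j).
Proof.
move=> pj k x v _ xk _ vk; rewrite evf_wform.
have [jk|ne] := eqVneq k j.2.
  by rewrite (monom0 xk) ?mul0r // /reduced jk eqxx subn0; apply/(forallP pj).
rewrite /whitney; case: (ord3_cases j.2 k) ne => ke; rewrite ?ke ?eqxx // => _.
  by rewrite -ke xk vk mul0r mulr0 subrr mulr0.
by rewrite -ke xk vk mul0r mulr0 subrr mulr0.
Qed.

(** The signature: the even permutations of three letters are the cyclic shifts, recognised by two
    consecutive values. *)
Definition perm_sign (p : 'S_3) : R := if p 1 == p 0 + 1 then 1 else -1.

(** Every permutation of the integers mod 3 is affine with slope 1 or -1. *)
Lemma perm3_cases (p : 'S_3) :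
  (p 1 == p 0 + 1 /\ forall i, p (i + 1) = p i + 1) \/
  ((p 1 == p 0 + 1) = false /\ forall i, p (i + 1) = p i + 1 + 1).
Proof.
have n1 : p 1 <> p 0 by move/perm_inj.
have n2 : p (1 + 1) <> p 0 by move/perm_inj.
have n3 : p (1 + 1) <> p 1 by move/perm_inj.
have [_ _ _ _ [d1 d2]] := ord3_neq (p 0).
case: (ord3_cases (p 0) (p 1)) => e1 //; [left|right].
  case: (ord3_cases (p 0) (p (1 + 1))) => e2 //; first by rewrite e2 e1 in n3.
  split; [exact/eqP|move=> i]; case: (ord3_cases 0 i) => ->; rewrite ?add0r //.
    by rewrite e1 e2.
  by rewrite -{1}(add0r (1 : 'I_3)) addI3 e2 addI3.
case: (ord3_cases (p 0) (p (1 + 1))) => e2 //; last by rewrite e2 e1 in n3.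
split=> [|i]; first by rewrite e1.
case: (ord3_cases 0 i) => ->; rewrite ?add0r //.
  by rewrite e1 e2 addI3.
by rewrite -{1}(add0r (1 : 'I_3)) addI3 e2 addI3.
Qed.

Lemma whitney_Sperm p i (x v : pt R) :
  whitney i (Sperm p x) (Sperm p v) = perm_sign p * whitney (p i) x v.
Proof.
rewrite /whitney /Sperm /perm_sign.
by case: (perm3_cases p) => -[-> pE]; rewrite !pE ?addI3; ring.
Qed.

Lemma monom_reduced_act p j (x : pt R) :
  monom (reduced (iact p j)) x = monom (reduced j) (Sperm p x).
Proof.
rewrite /monom (reindex_inj (@perm_inj _ p)); apply: eq_bigr => k _.
by rewrite /reduced /= actE (inj_eq perm_inj).
Qed.

(** Whitney forms are contractions with the position field, so they vanish on it. This allows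
    testing on arbitrary vectors projected to the tangent plane. *)
Lemma whitney_project i (x w : pt R) :
  whitney i x (fun k => w k - (\sum_l w l) * x k) = whitney i x w.
Proof. by rewrite /whitney; ring. Qed.

Lemma wform_kernel (N : nat) (c : form_index n -> R) :
  (forall j, ~~ okoff N j -> c j = 0) ->
  on_T2 (fun x v => \sum_j c j * evf (wform j) x v = 0) ->
  forall m i i', c (m, i) = c (m, i').
Proof.
move=> c0 ker m.
suff step a : c (m, a + 1) = c (m, a + 1 + 1).
  have step1 a : c (m, a) = c (m, a + 1) by have := step (a + 1 + 1); rewrite addI3.
  by move=> i i'; case: (ord3_cases i i') => ->; rewrite // (step1 i) // (step1 (i + 1)).
apply/eqP; rewrite -subr_eq0; apply/eqP.
apply: (@monom_free_supp _ _ N pred0 0 (fun m => c (m, a + 1) - c (m, a + 1 + 1)) _ _ _ m) => //.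
  move=> m' /negbTE dm; rewrite !c0 ?subrr //; by rewrite /okoff /= dm.
move=> x [x0 x1] _; pose w : pt R := fun k => (k == a)%:R.
have := ker x (fun k => w k - (\sum_l w l) * x k) (conj x0 x1).
(* At the projected basis vector [e_a], the forms of index [a + 1] and [a + 1 + 1] take the values
   [x_{a+2}] and [- x_{a+1}], that of index [a] vanishes; the factor [x a] then restores [x^m]. *)
rewrite /tangent sumrB -mulr_sumr x1 mulr1 subrr => /(_ erefl) /(congr1 (fun y => x a * y)).
rewrite mulr0 => e; rewrite -[RHS]e mulr_sumr sum_index; apply: eq_bigr => m' _.
rewrite (big3 _ _ a) /= !evf_wform /= !whitney_project /whitney /w !addI3.
have [-> -> _ _ _] := ord3_neq a; rewrite eqxx.
have cmon i : c (m', i) * monom (exps m') x =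
    c (m', i) * (monom (reduced (m', i)) x * (x (i + 1) * x (i + 1 + 1))).
  have [ok|nok] := boolP (okoff N (m', i)); last by rewrite c0 ?mul0r.
  by rewrite monom_reduced //; case/andP: ok.
rewrite mulrBl !cmon !addI3 /=; ring.
Qed.

Lemma wform_system A N (ok : pred (form_index n)) :
  (forall j, ok j -> A (wform j)) -> (forall j, ok j -> okoff N j) ->
  (forall p j, ok (iact p j) = ok j) ->
  (forall f, A f -> exists c : form_index n -> R, (forall j, ~~ ok j -> c j = 0) /\
    on_T2 (fun x v => evf f x v = \sum_j c j * evf (wform j) x v)) ->
  generating_system A N ok wform perm_sign.
Proof.
move=> okA okN ok_act spanA; split=> //.
- by move=> j /okN /andP [/eqP].
- move=> c c0; apply: (@wform_kernel N c) => j nok; apply: c0.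
  exact: contra (okN j) nok.
- move=> m okm x v _ _.
  have pm : positive m.
    by apply: positive_off_all => i; have /andP [] := okN _ (okm i).
  (* As [m] is positive, [x^m / (x_0 x_1 x_2)] is a monomial, and it factors out of the Koszul
     relation. *)
  have red i : monom (reduced (m, i)) x = monom (fun k => (m k).-1) x * x i.
    rewrite /monom (bigD1 i) //= [in RHS](bigD1 i) //= /reduced /= eqxx subn0.
    rewrite mulrAC -exprSr prednK; last exact/(forallP pm).
    by congr (_ * _); apply: eq_bigr => k ->; rewrite subn1.
  under eq_bigr do rewrite evf_wform red /=.
  by rewrite (big3 _ _ 0) /= /whitney !addI3; ring.
- move=> p j okj x v _ _; rewrite !evf_wform /= monom_reduced_act whitney_Sperm; ring.
- by move=> p; rewrite /perm_sign; case: ifP; [left|right].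
- by rewrite /perm_sign !rot3E add0r eqxx.
Qed.

(** Dividing by [x_{i+1} x_{i+2}] is a bijection from the multiples of this product in degree
    [r + 2] to the monomials of degree [r]; the hypothesis leaves room for the raised exponents. *)
Lemma sum_reduced (r : nat) (i : 'I_3) (F : expo n -> R) : (r.+2 <= n.+1)%N ->
  \sum_(m | deg m == r) F m =
  \sum_(m | okoff r.+2 (m, i)) F [ffun k => inord (reduced (m, i) k)].
Proof.
move=> rn; pose lower m : expo n := [ffun k => inord (reduced (m, i) k)].
pose raise m : expo n := [ffun k => inord (m k + (k != i))].
have lowerE m k : lower m k = (m k - (k != i))%N :> nat.
  by rewrite ffunE inordK // ltnS (leq_trans (leq_subr _ _)) // -ltnS.
have raise_lower m : (raise (lower m) == m) = positive_off (m, i).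
  have raiseE k : raise (lower m) k = (m k - (k != i) + (k != i))%N :> nat.
    rewrite ffunE lowerE inordK //; have := ltn_ord (m k).
    by case: (k != i) => /=; lia.
  apply/eqP/forallP => [e k|pm].
    by apply/implyP => /= ki; rewrite -[in m k]e raiseE ki addn1.
  apply/ffunP => k; apply/val_inj; rewrite /= raiseE; have := pm k => /=.
  by case: (k != i) => //= ?; rewrite ?subnK // subn0 addn0.
have deg_lower m : positive_off (m, i) -> deg m = (deg (lower m)).+2.
  move=> pm; have [e1 e2 _ _ _] := ord3_neq i.
  have := positive_offP pm (negbT e1); have := positive_offP pm (negbT e2).
  rewrite !(deg3 _ i) !lowerE e1 e2 eqxx /= subn0.
  move: (nat_of_ord _) (nat_of_ord _) (nat_of_ord _) => a b d; lia.
rewrite (reindex_onto lower raise) /=; last first.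
  move=> m /eqP dm; apply/ffunP => k; apply/val_inj; rewrite /= lowerE ffunE inordK ?addnK //.
  apply: leq_trans rn; rewrite ltnS -dm (deg3 _ k).
  by case: (k != i) => /=; lia.
apply: eq_bigl => m; rewrite raise_lower /okoff /= andbC.
by case: (boolP (positive_off _)) => [/deg_lower ->|]; rewrite ?andbT ?andbF.
Qed.

Lemma Pminus_span r f : (r < n)%N -> Pminus r f -> exists c : form_index n -> R,
  (forall j, ~~ okoff r.+1 j -> c j = 0) /\
  on_T2 (fun x v => evf f x v = \sum_j c j * evf (wform j) x v).
Proof.
move=> rn [eta [szeta [antieta fE]]].
pose h i := eta (i + 1) (i + 1 + 1).
have etaE b a : eta b a = \sum_i levi_civita i b a *: h i.
  have eta0 k : eta k k = 0.
    by apply/mpolyP => m; have := congr1 (mcoeff m) (antieta k k); rewrite mcoeffN mcoeff0; lra.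
  rewrite (big3 _ _ a) /= /levi_civita /h !addI3.
  have [e1 e2 e3 e4 [e5 e6]] := ord3_neq a.
  case: (ord3_cases a b) => ->; rewrite !(e1, e2, e3, e4, e5, e6, eqxx) /=;
    rewrite ?subrr ?subr0 ?sub0r ?scale0r ?scale1r ?scaleN1r ?addr0 ?add0r //.
have evfE x v : evf f x v = \sum_i (h i).@[x] * whitney i x v.
  rewrite -evf_contraction; apply: eq_bigr => a _; congr (_ * _).
  rewrite fE rmorph_sum; apply: eq_bigr => b _ /=.
  rewrite mevalM mevalXU etaE rmorph_sum; congr (_ * _).
  by apply: eq_bigr => i _; rewrite /= mevalZ.
(* For [r = 0] the size bound forces the 2-form to be zero; otherwise its coordinates are
   homogenised in degree one less than that of the space. *)
case: r rn szeta => [|r] rn szeta.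
  exists (fun=> 0); split=> // x v _ _; rewrite evfE !big1 // => i _; rewrite ?mul0r //.
  have := szeta (i + 1) (i + 1 + 1); rewrite leqn0 msize_poly_eq0 -/(h i) => /eqP ->.
  by rewrite meval0 mul0r.
have /fin_all_exists [c cE] := fun i => @homogenize R n r (h i) (ltnW (ltnW rn)) (szeta _ _).
exists (fun j => if okoff r.+2 j then c j.2 [ffun k => inord (reduced j k)] else 0).
split=> [j /negbTE -> //|x v Tx _].
rewrite evfE sum_index exchange_big; apply: eq_bigr => i _ /=.
rewrite cE // (sum_reduced i) ?(leq_trans rn) // big_mkcond mulr_suml; apply: eq_bigr => m _.
rewrite evf_wform; case: ifP => ok; rewrite ?mul0r // -mulrA; congr (_ * (_ * _)).
apply: eq_bigr => k _; rewrite /exps ffunE inordK //.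
by rewrite ltnS (leq_trans (leq_subr _ _)) // -ltnS.
Qed.

Lemma Pminus_system r : (r < n)%N ->
  generating_system (@Pminus R r) r.+1 (okoff r.+1) wform perm_sign.
Proof.
move=> rn; apply: wform_system => [j /andP [/eqP dj pj]|//|p j|f].
- exact: wform_Pminus.
- by rewrite /okoff positive_off_act deg_act.
- exact: Pminus_span.
Qed.

Lemma Pminus_traceless_system r : (r < n)%N ->
  generating_system (fun f => @Pminus R r f /\ traceless f) r.+1 (okpos r.+1)
    wform perm_sign.
Proof.
move=> rn; apply: wform_system.
- move=> j /andP [/eqP dj pj]; split; last exact: wform_traceless.
  exact/wform_Pminus/positiveW.
- by move=> j /andP [dj pj]; rewrite /okoff dj positiveW.
- by move=> p j; rewrite /okpos positive_act deg_act.
move=> f [fr tr]; have [c [c0 cE]] := Pminus_span rn fr.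
exists c; split=> // -[m i]; rewrite negb_and => nok.
have [ok|/c0 //] := boolP (okoff r.+1 (m, i)).
(* Such an index is admissible for [okoff] but not for [okpos], so the only exponent that can vanish
   is that at [i]. *)
have mi : m i = 0 :> nat.
  case/andP: ok => /= dm pm; move: nok; rewrite dm /= negb_forall => /existsP [k].
  rewrite -eqn0Ngt => /eqP mk; have [<- //|ki] := eqVneq k i.
  by have := positive_offP pm ki; rewrite mk.
apply: (@monom_free_supp _ _ r.+1 (pred1 i) (i + 1) (fun m => c (m, i)) _ _ _ m) => //.
- by have [/= -> _ _ _ _] := ord3_neq i.
- by move=> m' dm; rewrite c0 // /okoff negb_and dm.
- move=> x Tx xZ; have xi : x i = 0 by apply: xZ; exact: eqxx.
  have [e1 e2 e3 e4 [e5 e6]] := ord3_neq i.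
  (* On the edge vector of the face [x i = 0] only the Whitney form of index [i] survives, with
     value [x_{i+1} + x_{i+2} = 1]. Multiplying by [x_{i+1} x_{i+2}] restores [x^m]. *)
  have := cE x (unit_diff R (i + 1 + 1) (i + 1)) Tx (tangent_unit_diff _ _ _).
  rewrite (tr i) //; last 2 first.
  - exact: tangent_unit_diff.
  - by rewrite /unit_diff e3 e4 subrr.
  move/(congr1 (fun y => x (i + 1) * x (i + 1 + 1) * y)); rewrite mulr0 => e0; rewrite [RHS]e0.
  rewrite mulr_sumr sum_index; apply: eq_bigr => m' _.
  rewrite (big3 _ _ i) /= !evf_wform /= /whitney !addI3 /unit_diff e3 e4 e5 e6 !eqxx xi.
  have x12 : x (i + 1) + x (i + 1 + 1) = 1.
    by case: Tx => _; rewrite (big3 _ _ i) /= xi add0r.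
  have -> : c (m', i) * monom (exps m') x =
    c (m', i) * (monom (reduced (m', i)) x * (x (i + 1) * x (i + 1 + 1))).
    have [okm|nokm] := boolP (okoff r.+1 (m', i)); last by rewrite c0 ?mul0r.
    by rewrite monom_reduced //; case/andP: okm.
  rewrite -[LHS]mulr1 -[in LHS]x12 /=; ring.
- by move=> _ /eqP ->.
Qed.

End WhitneyFamily.

(** * Constant exponents and the arithmetic of the four cases *)

Definition cst_expo n (b : nat) : expo n := [ffun=> inord b].

Lemma cst_expoE n b k : (b <= n)%N -> cst_expo n b k = b :> nat.
Proof. by move=> bn; rewrite ffunE inordK. Qed.

Lemma deg_cst_expo n b : (b <= n)%N -> deg (cst_expo n b) = (3 * b)%N.
Proof. by move=> bn; rewrite (deg3 _ 0) !cst_expoE //; lia. Qed.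

Lemma positive_cst_expo n b : (b < n)%N -> positive (cst_expo n b.+1).
Proof. by move=> bn; apply/forallP => k; rewrite cst_expoE. Qed.

(** Rules out degree 0, which is what distinguishes [3 N_0 + 3] from [3 N_0]. *)
Lemma deg_positive n (m : expo n) : positive m -> (3 <= deg m)%N.
Proof.
move=> /forallP h; rewrite (deg3 m 0).
by have := h 0; have := h (0 + 1); have := h (0 + 1 + 1);
  move: (nat_of_ord _) (nat_of_ord _) (nat_of_ord _) => a b c; lia.
Qed.

Lemma has_inv_basis_iff (R : realType) n A N ok g s a r :
  @generating_system R n A N ok g s ->
  (forall m, full ok m -> (3 %| deg m)%N -> in3N0 a r) ->
  (in3N0 a r -> exists b, full ok (cst_expo n b)) ->
  has_inv_basis A <-> ~ in3N0 a r.
Proof.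
move=> gs bad cst; split=> [hA /cst [b fb]|nar].
  apply: (no_inv_basis_of_system gs fb _ hA).
  by apply/ffunP => k; rewrite !ffunE.
apply: (has_inv_basis_of_system gs) => m fm.
by apply/negP => /(bad m fm).
Qed.

Theorem theorem4p1 (R : realType) (r : nat) :
  (has_inv_basis (@Pr R r) <-> ~ in3N0 0 r) /\
  (has_inv_basis (@Pminus R r) <-> ~ in3N0 2 r) /\
  (has_inv_basis (fun f => @Pr R r f /\ traceless f) <-> ~ in3N0 3 r) /\
  (has_inv_basis (fun f => @Pminus R r f /\ traceless f) <-> ~ in3N0 2 r).
Proof.
(* The exponent bound [r.+1] is large enough for all four presentations. *)
have full_pos N (m : expo r.+1) : full (@okoff r.+1 N) m -> deg m = N /\ positive m.
  move=> /forallP fm; split; first by have /andP [/eqP] := fm 0.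
  by apply: positive_off_all => i; have /andP [] := fm i.
split; [|split; [|split]].
- apply: (has_inv_basis_iff (Pr_system R (leqnSn r))) => [m /forallP /(_ 0) /eqP /= ->|[q rq]].
    by move=> /dvdnP [q ->]; exists q; lia.
  exists q; apply/forallP => i; rewrite /okdeg /= deg_cst_expo ?rq ?addn0 //; lia.
- apply: (has_inv_basis_iff (Pminus_system R (ltnSn r))) =>
    [m /full_pos [dm /deg_positive]|[q rq]].
    by rewrite dm => lb /dvdnP [q rq]; exists q.-1; lia.
  (* Here [r = 3 q + 2], so the degree [r + 1] is three times [q + 1]. *)
  exists q.+1; apply/forallP => i.
  rewrite /okoff /= deg_cst_expo ?positiveW ?positive_cst_expo //; lia.
- apply: (has_inv_basis_iff (Pr_traceless_system R (leqnSn r))) =>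
    [m /full_pos [dm /deg_positive]|[q rq]].
    by rewrite dm => lb /dvdnP [q rq]; exists q.-1; lia.
  exists q.+1; apply/forallP => i.
  rewrite /okoff /= deg_cst_expo ?positiveW ?positive_cst_expo //; lia.
- apply: (has_inv_basis_iff (Pminus_traceless_system R (ltnSn r))) => [m|[q rq]].
    move=> /forallP /(_ 0) /andP [/eqP /= dm /deg_positive].
    by rewrite dm => lb /dvdnP [q rq]; exists q.-1; lia.
  exists q.+1; apply/forallP => i; rewrite /okpos /= deg_cst_expo ?positive_cst_expo //; lia.
Qed.
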